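(* Let $X$ be a real Banach space and let $\kappa$ be an infinite cardinal. Then: (1) If $X$ is a space of almost universal disposition for spaces of density $<\kappa$, then $X$ is $(\ell_\infty(\alpha),\beta)$-octahedral for any infinite cardinals $\alpha,\beta$ such that $\max\{2^{\alpha'},\beta'\}<\kappa$ holds for all cardinals $\alpha'<\alpha$, $\beta'<\beta$. (2) If $X$ is a space of universal disposition for spaces of density $<\kappa$, then $X$ is $(\ell_\infty(\alpha),\beta)$-rigid octahedral for any infinite cardinals $\alpha,\beta$ such that $\max\{2^{\alpha'},\beta'\}<\kappa$ holds for all cardinals $\alpha'<\alpha$, $\beta'<\beta$.
   Context: $\operatorname{dens}(E)$ is the least cardinality of a subset of $E$ whose linear span is dense in $E$ (so $\operatorname{dens}(E)=\dim E$ if $E$ is finite-dimensional). A Banach space $X$ is of universal disposition for spaces of density $<\kappa$ if for any two normed spaces $Y\subseteq Z$ with $\operatorname{dens}(Z)<\kappa$ and any (linear, into) isometry $t:Y\to X$ there exists a linear extension $T:Z\to X$ of $t$ which is an isometry. It is of almost universal disposition for spaces of density $<\kappa$ if for all such $Y,Z,t$ and every $\varepsilon>0$ there exists a linear extension $T:Z\to X$ of $t$ with $(1-\varepsilon)\Vert z\Vert\leq\Vert T(z)\Vert\leq(1+\varepsilon)\Vert z\Vert$ for every $z\in Z$. For a cardinal $\alpha'$, $\ell_\infty(\alpha')$ is the space of bounded real functions on a set of cardinality $\alpha'$ with the supremum norm. For infinite cardinals $\alpha,\beta$, a Banach space $X$ is $(\ell_\infty(\alpha),\beta)$-octahedral if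 for every subset $G\subseteq X$ with $|G|<\beta$, every cardinal $\alpha'<\alpha$ and every $\varepsilon>0$ there exists a bounded linear operator $\phi:\ell_\infty(\alpha')\longrightarrow X$ with $\Vert\phi\Vert\leq 1$ such that $\Vert z+\phi(y)\Vert\geq (1-\varepsilon)(\Vert z\Vert+\Vert y\Vert)$ for every $z\in G$ and $y\in\ell_\infty(\alpha')$. It is $(\ell_\infty(\alpha),\beta)$-rigid octahedral if the same condition holds with $\varepsilon=0$ (so that $\Vert z+\phi(y)\Vert=\Vert z\Vert+\Vert y\Vert$ for every $z\in G$, $y\in\ell_\infty(\alpha')$). *)

(* Defs.v *)
From HB Require Import structures.
From mathcomp Require Import all_boot all_order all_algebra.
From mathcomp Require Import boolp classical_sets functions cardinality.
From mathcomp Require Import reals ereal topology normedtype.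

Set Implicit Arguments.
Unset Strict Implicit.
Unset Printing Implicit Defensive.

Import Order.TTheory GRing.Theory Num.Theory.
Import numFieldNormedType.Exports.

Local Open Scope classical_set_scope.
Local Open Scope card_scope.
Local Open Scope ring_scope.

(* A cardinal is represented by (the full set of) a type, [set: K]. *)
Definition card_lt T U (A : set T) (B : set U) := (A #<= B) /\ ~ (B #<= A).
Notation "A '#<' B" := (card_lt A B) (at level 79, format "A  '#<'  B")
  : card_scope.

Lemma min_card (E : pointedType) (F : set (set E)) S0 : F S0 ->
  exists2 S, F S & forall S', F S' -> S #<= S'.
Proof.
move=> FS0.
pose P (A : set (set E -> E)) := forall S, F S ->
  (forall h, A h -> S (h S)) /\
  (forall h h', A h -> A h' -> h S = h' S -> h = h').
have [C CP Ctot|A [PA Amax]] := @Zorn_bigcup _ P.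
  move=> S FS; split.
    by move=> h [D CD Dh]; have [/(_ h Dh)] := CP D CD S FS.
  move=> h h' [D CD Dh] [D' CD' Dh'].
  have [DD'|D'D] := Ctot D D' CD CD'.
    by have [_] := CP D' CD' S FS; apply => //; exact: DD'.
  by have [_] := CP D CD S FS; apply => //; exact: D'D.
have [[S FS hS]|noS] := pselect (exists2 S, F S & S `<=` (fun h => h S) @` A).
  exists S => // S' FS'.
  apply: (card_le_trans (subset_card_le hS)).
  apply: (card_le_trans (card_image_le _ _)).
  have [A1 A2] := PA S' FS'.
  have /pcard_leP// : $|{injfun A >-> S'}|.
  apply/injfunPex; exists (fun h => h S'); first exact: A1.
  by move=> h h' /set_mem Ah /set_mem Ah'; exact: A2.
have /choice[h hP] : forall S, exists x : E, F S -> S x /\ ~ ((fun h => h S) @` A) x.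
  move=> S; have [FS|nFS] := pselect (F S); last by exists point.
  apply: contrapT => nx; apply: noS; exists S => // x Sx.
  by apply: contrapT => nAx; apply: nx; exists x.
exfalso; apply: (Amax (A `|` [set h])).
  split; first by move=> ? ?; left.
  move=> /(_ h (or_intror erefl)) Ah.
  by have [_] := hP _ FS0; apply; exists h.
move=> S FS; have [A1 A2] := PA S FS; have [h1 h2] := hP S FS; split.
  by move=> g [/A1//|->].
move=> g g' [Ag|->] [Ag'|->] //; first exact: A2.
  by move=> e; case: h2; exists g.
by move=> e; case: h2; exists g'.
Qed.

Section density.
Context (R : realType) (E : normedModType R).

Definition linear_span (S : set E) : set E :=
  [set v | exists n (a : 'I_n -> R) (x : 'I_n -> E),
     (forall i, S (x i)) /\ v = \sum_(i < n) a i *: x i].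

Definition densely_spans (S : set E) := dense (linear_span S).

(* D realizes the least cardinality of a densely spanning set, so that
   dens(E) is the cardinality of D. *)
Definition is_dens (D : set E) :=
  densely_spans D /\ forall S, densely_spans S -> D #<= S.

Definition dens_lt (K : Type) := exists D, is_dens D /\ D #< [set: K].

Lemma dens_ltP (K : Type) :
  dens_lt K <-> exists D : set E, densely_spans D /\ D #< [set: K].
Proof.
split=> [[D [[DE _] DK]]|[D [DE [DK KD]]]]; first by exists D.
have [D' D'E minD'] := min_card DE.
exists D'; split; first by split.
split; first exact: card_le_trans (minD' D DE) DK.
by move=> KD'; apply: KD; exact: card_le_trans KD' (minD' D DE).
Qed.

End density.

Arguments dens_lt {R} E K.

(* In the next two definitions, Y is the linear subspace P of Z with the norm
   inherited from Z: a vector y : Y has norm `|\val y|. *)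
Definition universal_disposition (R : realType) (X : normedModType R)
    (K : Type) :=
  forall (Z : normedModType R) (P : {pred Z}) (Y : subLmodType P)
    (t : {linear Y -> X}),
    dens_lt Z K ->
    (forall y, `|t y| = `|\val y|) ->
    exists T : {linear Z -> X},
      (forall y : Y, T (\val y) = t y) /\ (forall z, `|T z| = `|z|).

Definition almost_universal_disposition (R : realType) (X : normedModType R)
    (K : Type) :=
  forall (Z : normedModType R) (P : {pred Z}) (Y : subLmodType P)
    (t : {linear Y -> X}),
    dens_lt Z K ->
    (forall y, `|t y| = `|\val y|) ->
    forall e : R, 0 < e ->
    exists T : {linear Z -> X},
      (forall y : Y, T (\val y) = t y) /\
      (forall z, (1 - e) * `|z| <= `|T z| <= (1 + e) * `|z|).

Section linf.
Context (R : realType) (T : Type).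

Definition bounded_pred : {pred T -> R} := mem (bounded_fun : set (T -> R)).

Record linf := Linf {
  linf_fun :> T -> R;
  linf_bounded : linf_fun \in bounded_pred }.

HB.instance Definition _ := [isSub for linf_fun].
HB.instance Definition _ := [Choice of linf by <:].

Lemma bounded_predP (f : T -> R) :
  f \in bounded_pred <-> exists M, forall x, `|f x| <= M.
Proof.
rewrite inE /=; split.
  move=> [M [_ /(_ (M + 1))fM]]; exists (M + 1) => x.
  by apply: fM => //; rewrite ltrDl.
move=> [M fM]; exists M; split => [|N MN x _]; first exact: num_real.
exact: le_trans (fM x) (ltW MN).
Qed.

Lemma bounded_pred_submod_closed : submod_closed bounded_pred.
Proof.
split; first by apply/bounded_predP; exists 0 => x; rewrite normr0.
move=> a f g /bounded_predP[M fM] /bounded_predP[N gN].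
apply/bounded_predP; exists (`|a| * M + N) => x.
apply: (le_trans (ler_normD _ _)); apply: lerD (gN x).
by rewrite normrM ler_wpM2l.
Qed.

HB.instance Definition _ :=
  GRing.isSubmodClosed.Build _ _ bounded_pred bounded_pred_submod_closed.
HB.instance Definition _ := [SubChoice_isSubLmodule of linf by <:].

(* For empty T this is sup set0 = 0. *)
Definition linf_norm (f : linf) : R := sup (range (fun x => `|f x|)).

Lemma linf_norm_ub (f : linf) x : `|f x| <= linf_norm f.
Proof.
have /bounded_predP[M fM] := linf_bounded f.
apply: ub_le_sup; last by exists x.
by exists M => _ [y _ <-]; exact: fM.
Qed.

Lemma linf_norm_ge0 (f : linf) : 0 <= linf_norm f.
Proof.
have [[x _]|T0] := pselect ([set: T] !=set0).
  exact: le_trans (normr_ge0 (f x)) (linf_norm_ub f x).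
have T_empty : [set: T] = set0.
  by apply/seteqP; split => // x _; apply: T0; exists x.
by rewrite /linf_norm T_empty image_set0 sup0.
Qed.

Lemma linf_norm_le (f : linf) M :
  0 <= M -> (forall x, `|f x| <= M) -> linf_norm f <= M.
Proof.
move=> M0 fM; have [[x _]|T0] := pselect ([set: T] !=set0).
  by apply: ge_sup; [exists `|f x|, x | move=> _ [y _ <-]; exact: fM].
have T_empty : [set: T] = set0.
  by apply/seteqP; split => // x _; apply: T0; exists x.
by rewrite /linf_norm T_empty image_set0 sup0.
Qed.

Lemma linf_normD (f g : linf) : linf_norm (f + g) <= linf_norm f + linf_norm g.
Proof.
apply: linf_norm_le => [|x]; first by rewrite addr_ge0 ?linf_norm_ge0.
by apply: le_trans (ler_normD _ _) _; rewrite lerD ?linf_norm_ub.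
Qed.

Lemma linf_normZ (a : R) (f : linf) : linf_norm (a *: f) = `|a| * linf_norm f.
Proof.
apply/eqP; rewrite eq_le; apply/andP; split.
  apply: linf_norm_le => [|x]; first by rewrite mulr_ge0 ?linf_norm_ge0.
  by rewrite normrM ler_wpM2l ?linf_norm_ub.
have [->|a0] := eqVneq a 0; first by rewrite normr0 mul0r linf_norm_ge0.
have na0 : 0 < `|a| by rewrite normr_gt0.
rewrite -ler_pdivlMl//; apply: linf_norm_le => [|x].
  by rewrite mulr_ge0 ?invr_ge0 ?linf_norm_ge0.
by rewrite ler_pdivlMl// -normrM; exact: (linf_norm_ub (a *: f) x).
Qed.

Lemma linf_norm_eq0 (f : linf) : linf_norm f = 0 -> f = 0.
Proof.
move=> f0; apply/val_inj/funext => x; apply/eqP.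
by rewrite -normr_le0 -f0; exact: linf_norm_ub.
Qed.

HB.instance Definition _ :=
  Lmodule_isNormed.Build R linf linf_normD linf_normZ linf_norm_eq0.

End linf.

(* Extended-real valued: finite exactly when phi is bounded. *)
Definition op_norm (R : realType) (V W : normedModType R)
    (phi : {linear V -> W}) : \bar R :=
  ereal_sup [set `|phi v|%:E | v in [set v | `|v| <= 1]].

(* The octahedrality condition for one given value of epsilon. *)
Definition octahedral_at (R : realType) (X : normedModType R) (A B : Type)
    (e : R) :=
  forall (G : set X) (A' : Type), G #< [set: B] -> [set: A'] #< [set: A] ->
    exists phi : {linear linf R A' -> X},
      (op_norm phi <= 1%:E)%E /\
      (forall z y, G z -> (1 - e) * (`|z| + `|y|) <= `|z + phi y|).

Definition linf_octahedral (R : realType) (X : normedModType R) (A B : Type) :=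
  forall e : R, 0 < e -> octahedral_at X A B e.

Definition linf_rigid_octahedral (R : realType) (X : normedModType R)
    (A B : Type) :=
  octahedral_at X A B 0.

(* Main.v *)
(* Let Z be the l1-sum of the span Y of G and of l_oo(A').  It is densely
   spanned by G together with the indicator functions of the subsets of A', hence has
   density < K.  Extending the inclusion Y -> X to an (almost) isometry
   T : Z -> X and restricting T to the summand l_oo(A') gives phi, because
   `|z + phi y| = `|T (z, y)| while `|(z, y)| = `|z| + `|y|.  In the almost
   isometric case T is e-distorting, and dividing the restriction by 1 + e makes
   it a contraction at the cost of a factor 1 - 2 e in the lower bound. *)
Require Import Defs.
From HB Require Import structures.
From mathcomp Require Import all_boot all_order all_algebra.
From mathcomp Require Import boolp classical_sets functions cardinality.
From mathcomp Require Import reals ereal topology normedtype.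
From mathcomp Require Import lra.

Set Implicit Arguments.
Unset Strict Implicit.
Unset Printing Implicit Defensive.

Import Order.TTheory GRing.Theory Num.Theory.
Import numFieldNormedType.Exports.

Local Open Scope classical_set_scope.
Local Open Scope card_scope.
Local Open Scope ring_scope.

(** * Cardinal arithmetic with infinite sets *)

(* By Zorn, choose a maximal family [F] of sequences in [A] with pairwise
   disjoint ranges: it covers [A] up to a finite set, which is absorbed by one
   of the sequences. *)
Lemma infinite_setX_nat (T : pointedType) (A : set T) : infinite_set A ->
  exists F : set (nat -> T),
    F `*` [set: nat] #<= A /\ A #<= F `*` [set: nat].
Proof.
move=> Ainf.
(* The last clause encodes both that each sequence is injective and that distinct sequences have
   disjoint ranges. *)
pose P (F : set (nat -> T)) := forall s, F s -> (forall n, A (s n)) /\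
  forall s' n m, F s' -> s n = s' m -> s = s' /\ n = m.
have seqA (C : set T) : infinite_set C ->
    exists s : nat -> T, (forall n, C (s n)) /\ injective s.
  move=> /infiniteP/pcard_leP/injfunPex[f fC finj].
  by exists f; split=> [n|n m]; [exact: fC | apply: finj; rewrite in_setT].
have [C CP Ctot|F [PF Fmax]] := @Zorn_bigcup _ P.
  move=> s [D CD Ds]; split; first by case: (CP D CD s Ds).
  move=> s' n m [D' CD' D's'].
  have [DD'|D'D] := Ctot D D' CD CD'.
    by have [_] := CP D' CD' s (DD' _ Ds); apply.
  by have [_] := CP D CD s Ds; apply; exact: D'D.
pose E := A `\` [set x | exists s n, F s /\ x = s n].
have Efin : finite_set E.
  apply: contrapT => /seqA[s [sE sinj]].
  apply: (Fmax (F `|` [set s])).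
    split; first by move=> ? ?; left.
    move=> /(_ s (or_intror erefl)) Fs.
    by have [_] := sE 0%N; apply; exists s, 0%N.
  move=> s1 [Fs1|->].
    have [s1A s1F] := PF _ Fs1; split=> // s' n m [Fs'|->]; first exact: s1F.
    by move=> e; have [_] := sE m; case; exists s1, n.
  split=> [n|s' n m [Fs'|->] e]; first by have [] := sE n.
    by have [_] := sE n; case; exists s', m.
  by split => //; exact: sinj.
have [s0 Fs0] : F !=set0.
  apply: contrapT => F0; apply: Ainf; apply: sub_finite_set Efin => x Ax.
  by split=> // -[s [_ [Fs _]]]; apply: F0; exists s.
exists F; split.
  apply/pcard_leP/injfunPex; exists (fun p => p.1 p.2).
    by move=> [s n] [/= Fs _]; have [] := PF s Fs.
  move=> [s n] [s' m] /set_mem[/= Fs _] /set_mem[/= Fs' _] e.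
  by have [_ /(_ s' n m Fs' e)[-> ->]] := PF s Fs.
have /pcard_surjP[h hE] : E #<= [set: nat] by exact: finite_set_countable.
(* [h'] takes the place of [s0]: its odd indices run through [s0], its even ones through a sequence
   [h] covering the leftover set [E]. *)
pose h' k := if odd k then s0 k./2 else h k./2.
apply/pcard_surjP; exists (fun p => if p.1 == s0 then h' p.2 else p.1 p.2).
move=> x Ax; have [[s [n [Fs ->]]]|nx] := pselect (exists s n, F s /\ x = s n).
  have [->|ss0] := eqVneq s s0; last by exists (s, n); rewrite ?(negbTE ss0).
  by exists (s0, n.*2.+1); rewrite //= eqxx /h' /= odd_double uphalf_double.
have [|m _ <-] := hE x; first by [].
by exists (s0, m.*2); rewrite //= eqxx /h' odd_double doubleK.
Qed.

(** As [C] is equipotent to some [F * nat], embed [A] using even second coordinates and the rest of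
    [B] using odd ones. *)
Lemma infinite_setU_card_le T U (A B : set T) (C : set U) : infinite_set C ->
  A #<= C -> B #<= C -> A `|` B #<= C.
Proof.
elim/Ppointed: U => U in C *; first by rewrite !emptyE => /(_ (finite_set0 _)).
move=> /infinite_setX_nat[F [FC CF]] AC BC; apply: card_le_trans FC.
have /pcard_leP/injfunPex[f fF finj] := card_le_trans AC CF.
have /pcard_leP/injfunPex[g gF ginj] := card_le_trans BC CF.
apply/pcard_leP/injfunPex.
exists (fun x => if x \in A then ((f x).1, (f x).2.*2)
                 else ((g x).1, (g x).2.*2.+1)).
  move=> x; case: ifPn => [/set_mem/fF[? _] _|xA [/mem_set|/gF[? _]]] //.
  by rewrite (negbTE xA).
have xB x : x \notin A -> x \in A `|` B -> x \in B.
  by rewrite in_setU => /negbTE->.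
move=> x y xAB yAB; case: ifPn => xA; case: ifPn => yA [].
- by move=> e1 /double_inj e2; apply: finj => //; apply: injective_projections.
- by move=> _ /(congr1 odd); rewrite /= !odd_double.
- by move=> _ /(congr1 odd); rewrite /= !odd_double.
- move=> e1 /double_inj e2; apply: ginj; rewrite ?xB//.
  exact: injective_projections.
Qed.

(** A member of least cardinality in the pair [A], [B] embeds into the other. *)
Lemma card_le_total (T : pointedType) (A B : set T) : A #<= B \/ B #<= A.
Proof.
have [S [->|->] Smin] := @min_card T [set A; B] A (or_introl erefl).
  by left; apply: Smin; right.
by right; apply: Smin; left.
Qed.

Lemma card_le_lt_trans T U V (A : set T) (B : set U) (C : set V) :
  A #<= B -> B #< C -> A #< C.
Proof.
move=> AB [BC CB]; split; first exact: card_le_trans AB BC.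
by move=> CA; apply: CB; exact: card_le_trans CA AB.
Qed.

(** With [B] the larger set, the union is finite if [B] is finite, and otherwise embeds into [B]. *)
Lemma card_lt_setU (T : pointedType) (K : Type) (A B : set T) :
  infinite_set [set: K] -> A #< [set: K] -> B #< [set: K] ->
  (A `|` B) #< [set: K].
Proof.
move=> Kinf [AK KA] [BK KB]; split; first exact: infinite_setU_card_le.
wlog AB : A B AK KA BK KB / A #<= B.
  by move=> H; have [/H|/H] := card_le_total A B; [|rewrite setUC]; apply.
move=> KAB; have [Bfin|Binf] := pselect (finite_set B).
  apply: Kinf; apply: (card_le_finite KAB).
  by rewrite finite_setU; split=> //; exact: card_le_finite Bfin.
apply: KB; apply: (card_le_trans KAB).
exact: infinite_setU_card_le.
Qed.

(** * Linear spans and a metric criterion for their density *)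

Section linear_span_theory.
Context (R : realType).
Implicit Types E F : normedModType R.

Lemma sub_linear_span E (S : set E) : S `<=` linear_span S.
Proof.
move=> x Sx; exists 1%N, (fun=> 1), (fun=> x); split=> //.
by rewrite big_ord1 scale1r.
Qed.

Lemma linear_spanZD E (S : set E) a u v :
  linear_span S u -> linear_span S v -> linear_span S (a *: u + v).
Proof.
move=> [n [b [x [Sx ->]]]] [m [c [y [Sy ->]]]].
exists (n + m)%N,
  (fun i : 'I_(n + m) =>
     match fintype.split i with inl j => a * b j | inr j => c j end),
  (fun i => match fintype.split i with inl j => x j | inr j => y j end).
split=> [i|]; first by case: (fintype.split i).
rewrite big_split_ord scaler_sumr; congr (_ + _); apply: eq_bigr => i _.
  by rewrite (unsplitK (inl i)) scalerA.
by rewrite (unsplitK (inr i)).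
Qed.

Lemma linear_span0 E (S : set E) : linear_span S 0.
Proof.
exists 0%N, (fun=> 0), (fun=> 0); split; first by case.
by rewrite big_ord0.
Qed.

Lemma linear_spanS E (S S' : set E) :
  S `<=` S' -> linear_span S `<=` linear_span S'.
Proof.
by move=> SS' _ [n [a [x [Sx ->]]]]; exists n, a, x; split=> // i; exact: SS'.
Qed.

Lemma linear_spanD E (S : set E) u v :
  linear_span S u -> linear_span S v -> linear_span S (u + v).
Proof. by move=> Su Sv; rewrite -[u]scale1r; exact: linear_spanZD. Qed.

Lemma linear_spanZ E (S : set E) a u :
  linear_span S u -> linear_span S (a *: u).
Proof.
by move=> Su; rewrite -[_ *: _]addr0; apply: linear_spanZD (linear_span0 S).
Qed.

Lemma linear_span_image E F (f : {linear E -> F}) (S : set E) u :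
  linear_span S u -> linear_span (f @` S) (f u).
Proof.
move=> [n [a [x [Sx ->]]]]; exists n, a, (fun i => f (x i)).
split=> [i|]; first by exists (x i).
by rewrite linear_sum; apply: eq_bigr => i _; rewrite linearZ.
Qed.

Lemma densely_spansP E (S : set E) :
  (forall u e, 0 < e -> exists2 v, linear_span S v & `|u - v| < e) ->
  densely_spans S.
Proof.
move=> H O [u Ou] Oo.
have /nbhs_ballP[e /= e0 uO] := open_nbhs_nbhs (conj Oo Ou).
have [v Sv uv] := H u e e0; exists v; split=> //.
by apply: uO; rewrite -ball_normE.
Qed.

End linear_span_theory.

(** * The span of a set as a normed space *)

Section span_space.
Context (R : realType) (X : normedModType R) (G : set X).

Definition span_pred : {pred X} := mem (linear_span G).

(** A type of its own, so that it can carry a norm and serve as a summand of the l1-sum. *)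
Definition span_space := {x : X | x \in span_pred}.

Lemma span_pred_submod_closed : submod_closed span_pred.
Proof.
split; first by rewrite inE; exact: linear_span0.
by move=> a u v; rewrite !inE; exact: linear_spanZD.
Qed.

HB.instance Definition _ :=
  GRing.isSubmodClosed.Build _ _ span_pred span_pred_submod_closed.
HB.instance Definition _ := SubType.on span_space.
HB.instance Definition _ := [Choice of span_space by <:].
HB.instance Definition _ := [SubChoice_isSubLmodule of span_space by <:].

Let norm (u : span_space) := `|val u|.

Let normD u v : norm (u + v) <= norm u + norm v.
Proof. exact: ler_normD. Qed.

Let normZ (a : R) u : norm (a *: u) = `|a| * norm u.
Proof. by rewrite /norm linearZ normrZ. Qed.

Let norm_eq0 u : norm u = 0 -> u = 0.
Proof. by move=> /normr0_eq0 u0; apply: val_inj. Qed.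

HB.instance Definition _ :=
  Lmodule_isNormed.Build R span_space normD normZ norm_eq0.

Lemma span_space_normE (u : span_space) : `|u| = `|val u|.
Proof. by []. Qed.

(** The vectors of a combination representing [u] lie in [G], hence lift to the subtype. This bounds
    the number of generators by the cardinality of [G]. *)
Lemma span_space_spanned (u : span_space) :
  linear_span ((val : span_space -> X) @^-1` G) u.
Proof.
case: u => u uG; have /set_mem[n [a [x [Gx ux]]]] := uG.
have xG i : x i \in span_pred by rewrite inE; exact: sub_linear_span.
exists n, a, (fun i => Sub (x i) (xG i)); split=> //.
apply: val_inj; rewrite [RHS]linear_sum [LHS]ux; apply: eq_bigr => i _.
by rewrite linearZ.
Qed.

End span_space.

(** * The l1-sum of two normed spaces *)

Section l1sum.
Context (R : realType) (V W : normedModType R).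

(** An alias of the product, to be given the sum norm instead of the max norm. *)
Definition l1sum : Type := (V * W)%type.

HB.instance Definition _ := GRing.Lmodule.copy l1sum (V * W)%type.

Let norm (p : l1sum) : R := `|p.1| + `|p.2|.

Let normD p q : norm (p + q) <= norm p + norm q.
Proof. by rewrite /norm addrACA lerD// ler_normD. Qed.

Let normZ (a : R) p : norm (a *: p) = `|a| * norm p.
Proof. by rewrite /norm mulrDr -!normrZ. Qed.

Let norm_eq0 p : norm p = 0 -> p = 0.
Proof.
move=> /eqP; rewrite paddr_eq0// !normr_eq0 => /andP[/eqP p1 /eqP p2].
by case: p p1 p2 => /= ? ? -> ->.
Qed.

HB.instance Definition _ :=
  Lmodule_isNormed.Build R l1sum normD normZ norm_eq0.

Lemma l1sum_normE (p : l1sum) : `|p| = `|p.1| + `|p.2|.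
Proof. by []. Qed.

Definition l1inl (v : V) : l1sum := (v, 0).
Definition l1inr (w : W) : l1sum := (0, w).

Let l1inl_linear : linear l1inl.
Proof.
by move=> a u v; apply: injective_projections; rewrite /= ?scaler0 ?addr0.
Qed.

Let l1inr_linear : linear l1inr.
Proof.
by move=> a u v; apply: injective_projections; rewrite /= ?scaler0 ?addr0.
Qed.

HB.instance Definition _ := GRing.isLinear.Build R V l1sum _ l1inl l1inl_linear.
HB.instance Definition _ := GRing.isLinear.Build R W l1sum _ l1inr l1inr_linear.

Lemma l1sum_split (p : l1sum) : p = l1inl p.1 + l1inr p.2.
Proof. by case: p => v w; congr pair; rewrite /= ?addr0 ?add0r. Qed.

(** The first summand recast as a subspace of the sum, the form in which disposition takes its
    [Y]. *)
Definition left_pred : {pred l1sum} := [pred p | p.2 == 0].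

Definition left_summand := {p : l1sum | p \in left_pred}.

Lemma left_pred_submod_closed : submod_closed left_pred.
Proof.
split; first by rewrite inE.
by move=> a p q; rewrite !inE /= => /eqP-> /eqP->; rewrite scaler0 addr0.
Qed.

HB.instance Definition _ :=
  GRing.isSubmodClosed.Build _ _ left_pred left_pred_submod_closed.
HB.instance Definition _ := SubType.on left_summand.
HB.instance Definition _ := [Choice of left_summand by <:].
HB.instance Definition _ := [SubChoice_isSubLmodule of left_summand by <:].

Lemma l1inl_left v : l1inl v \in left_pred.
Proof. by rewrite inE. Qed.

(** Only the second coordinate needs approximation, since [S] spans [V] exactly. *)
Lemma densely_spans_l1sum (S : set V) (S' : set W) :
  (forall v, linear_span S v) -> densely_spans S' ->
  densely_spans (l1inl @` S `|` l1inr @` S').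
Proof.
move=> VS WS'; apply: densely_spansP => p e e0.
have [w [pw S'w]] := WS' _ (ex_intro _ p.2 (ballxx _ e0)) (ball_open _ _).
exists (l1inl p.1 + l1inr w).
  apply: linear_spanD.
    apply: linear_spanS (linear_span_image l1inl (VS p.1)).
    by move=> ? ?; left.
  apply: linear_spanS (linear_span_image l1inr S'w).
  by move=> ? ?; right.
rewrite {1}[p]l1sum_split opprD addrACA subrr add0r -linearB l1sum_normE.
by rewrite normr0 add0r; move: (pw : ball p.2 e w); rewrite -ball_normE.
Qed.

End l1sum.

Arguments l1inl {R V} W v.
Arguments l1inr {R} V {W} w.

(** * Indicator functions span a dense subspace of l_oo *)

Section indicators.
Context (R : realType) (T : Type).

Lemma indic_bounded (D : set T) :
  (fun x => if x \in D then 1 else 0) \in @bounded_pred R T.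
Proof.
by apply/bounded_predP; exists 1 => x; case: ifP; rewrite ?normr1 ?normr0.
Qed.

Definition linf_indic (D : set T) : linf R T := Linf (indic_bounded D).

(** Subtracting [M / 2] where [f] is positive and adding it elsewhere moves the values from
    [[-M, M]] into [[-M / 2, M / 2]]. *)
Lemma linf_halving (f : linf R T) M : 0 <= M -> `|f| <= M ->
  exists2 g, linear_span (range linf_indic) g & `|f - g| <= M / 2.
Proof.
move=> M0 fM; pose D := [set x | 0 < f x].
exists (M / 2 *: linf_indic D + - (M / 2) *: linf_indic (~` D)).
  by apply: linear_spanD; apply: linear_spanZ; apply: sub_linear_span;
    [exists D|exists (~` D)].
apply: linf_norm_le => [|x]; first by rewrite divr_ge0.
have := le_trans (linf_norm_ub f x) fM; rewrite ler_norml => /andP[f1 f2].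
change (`|f x - (M / 2 * (if x \in D then 1 else 0) +
  - (M / 2) * (if x \in ~` D then 1 else 0))| <= M / 2).
rewrite in_setC ler_norml; have [/set_mem|/negP] := boolP (x \in D).
  by rewrite /D /=; lra.
by rewrite in_setE /D /= => /negP; rewrite -leNgt; lra.
Qed.

Lemma densely_spans_indic : densely_spans (range linf_indic).
Proof.
apply: densely_spansP => f e e0.
(* Iterated halving: each round approximates the remainder of the previous one. *)
have H n : exists2 g, linear_span (range linf_indic) g &
    `|f - g| <= `|f| / 2 ^+ n.
  elim: n => [|n [g Sg fg]].
    by exists 0; [exact: linear_span0|rewrite subr0 expr0 divr1].
  have [|h Sh gh] := linf_halving _ fg; first by rewrite divr_ge0// exprn_ge0.
  exists (g + h); first exact: linear_spanD.
  by rewrite opprD addrA exprSr invfM mulrA.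
have [n ne] : exists n, `|f| / 2 ^+ n < e.
  (* [Num.bound x] is an [n] with [x < 2 ^+ n]. *)
  exists (Num.bound (`|f| / e)).
  by rewrite ltr_pdivrMr ?exprn_gt0// mulrC -ltr_pdivrMr// upper_nthrootP.
by have [g Sg fg] := H n; exists g => //; exact: le_lt_trans ne.
Qed.

End indicators.

(** * From an extension of the inclusion to octahedrality *)

Section octahedral_of_disposition.
Context (R : realType) (X : normedModType R) (A' : Type) (G : set X).

Let Z := l1sum (span_space G) (linf R A').

Definition left_inclusion (y : left_summand (span_space G) (linf R A')) : X :=
  val (val y).1.

Let left_inclusion_linear : linear left_inclusion.
Proof. by []. Qed.

HB.instance Definition _ :=
  GRing.isLinear.Build R _ X _ left_inclusion left_inclusion_linear.

Lemma left_inclusion_isometric y : `|left_inclusion y| = `|val y|.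
Proof. by rewrite l1sum_normE (eqP (valP y)) normr0 addr0. Qed.

(** The generators from [G] number at most the cardinality of [G], the indicators at most that of
    the power set of [A']; the union stays below the infinite [K]. *)
Lemma l1sum_dens_lt (K : Type) : infinite_set [set: K] ->
  G #< [set: K] -> [set: set A'] #< [set: K] -> dens_lt Z K.
Proof.
move=> infK GK AK; pose G' := (val : span_space G -> X) @^-1` G.
apply/dens_ltP; exists (l1inl (linf R A') @` G' `|`
  l1inr (span_space G) @` range (@linf_indic R A')).
split.
  apply: densely_spans_l1sum (@densely_spans_indic R A').
  exact: span_space_spanned.
apply: card_lt_setU infK _ _;
  [apply: card_le_lt_trans GK|apply: card_le_lt_trans AK].
  apply: card_le_trans (card_image_le _ _) _.
  by apply: card_ge_preimage => u v _ _; exact: val_inj.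
by do 2 (apply: card_le_trans (card_image_le _ _) _).
Qed.

(** Allowing [e = 0] lets one argument serve both the almost isometric and the isometric case. *)
Lemma octahedral_extension (e : R) (T : {linear Z -> X}) : 0 <= e ->
  (forall y : left_summand _ _, T (val y) = left_inclusion y) ->
  (forall z, (1 - e) * `|z| <= `|T z| <= (1 + e) * `|z|) ->
  exists phi : {linear linf R A' -> X}, (op_norm phi <= 1%:E)%E /\
    forall z y, G z -> (1 - e * 2) * (`|z| + `|y|) <= `|z + phi y|.
Proof.
move=> e0 Tt TZ; have e1 : 0 < 1 + e by lra.
pose c := (1 + e)^-1; have c0 : 0 < c by rewrite invr_gt0.
have ce : c * (1 + e) = 1 by rewrite mulVf// gt_eqF.
pose phi : {linear linf R A' -> X} := T \o (l1inr (span_space G) \o *:%R c).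
exists phi; split.
  apply: ge_ereal_sup => _ [y y1 <-]; rewrite lee_fin.
  have /andP[_] := TZ (l1inr _ (c *: y)).
  move=> /le_trans; apply.
  rewrite l1sum_normE normr0 add0r normrZ gtr0_norm// mulrA [_ * c]mulrC ce.
  by rewrite mul1r.
move=> z y Gz.
have zG : z \in span_pred G by rewrite inE; exact: sub_linear_span.
pose z' : span_space G := Sub z zG.
(* The vector lies in the left summand, where [T] is the inclusion into [X]. *)
have Tz : T (l1inl _ z') = z := Tt (Sub (l1inl _ z') (l1inl_left _ z')).
have /andP[+ _] := TZ (l1inl _ z' + l1inr _ (c *: y)).
rewrite linearD Tz; apply: le_trans.
rewrite l1sum_normE /= addr0 add0r [`|z'|]span_space_normE normrZ gtr0_norm//.
have [z0 y0] := (normr_ge0 z, normr_ge0 y).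
rewrite !mulrDr; apply: lerD; first by rewrite ler_wpM2r//; lra.
(* It remains that [1 - 2 e <= (1 - e) c], which holds because [(1 - 2 e) (1 + e) = 1 - e - 2 e^2 <=
   1 - e]. *)
rewrite mulrA ler_wpM2r//; nra.
Qed.

End octahedral_of_disposition.

Theorem theorem6p4 (R : realType) (X : completeNormedModType R) (K : Type)
    (infK : infinite_set [set: K]) :
  (almost_universal_disposition X K ->
   forall A B : Type, infinite_set [set: A] -> infinite_set [set: B] ->
     (forall A' B' : Type, [set: A'] #< [set: A] -> [set: B'] #< [set: B] ->
        [set: set A'] #< [set: K] /\ [set: B'] #< [set: K]) ->
     linf_octahedral X A B) /\
  (universal_disposition X K ->
   forall A B : Type, infinite_set [set: A] -> infinite_set [set: B] ->
     (forall A' B' : Type, [set: A'] #< [set: A] -> [set: B'] #< [set: B] ->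
        [set: set A'] #< [set: K] /\ [set: B'] #< [set: K]) ->
     linf_rigid_octahedral X A B).
Proof.
(* The cardinal hypothesis speaks of types, so it is applied to [G] viewed as a type, equipotent to
   the set [G]. *)
have bounds A B (G : set X) A' :
    (forall A' B' : Type, [set: A'] #< [set: A] -> [set: B'] #< [set: B] ->
      [set: set A'] #< [set: K] /\ [set: B'] #< [set: K]) ->
    G #< [set: B] -> [set: A'] #< [set: A] ->
    [set: set A'] #< [set: K] /\ G #< [set: K].
  move=> ABK GB A'A; have /andP[GT TG] : (G #<= [set: G]) && ([set: G] #<= G).
    by rewrite -card_eq_le card_setT_sym.
  have [AK GK] := ABK A' G A'A (card_le_lt_trans TG GB).
  by split=> //; exact: card_le_lt_trans GT GK.
split=> [Xdisp A B _ _ ABK e e0|Xdisp A B _ _ ABK] G A' GB A'A;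
    have [AK GK] := bounds A B G A' ABK GB A'A.
  (* Distortion [e / 2] compensates for the factor 2 lost in the rescaling. *)
  have [|T [Tt TZ]] := Xdisp _ _ _ (@left_inclusion _ X A' G)
    (l1sum_dens_lt infK GK AK) (@left_inclusion_isometric _ _ _ _) (e / 2).
    by rewrite divr_gt0.
  have [|phi] := octahedral_extension _ Tt TZ; first by rewrite divr_ge0// ltW.
  by rewrite divfK// => phiP; exists phi.
have [T [Tt TZ]] := Xdisp _ _ _ (@left_inclusion _ X A' G)
  (l1sum_dens_lt infK GK AK) (@left_inclusion_isometric _ _ _ _).
(* An isometric [T] is the case of distortion 0. *)
have [|phi] := octahedral_extension (lexx 0) Tt.
  by move=> z; rewrite TZ subr0 addr0 mul1r lexx.
by rewrite mul0r => phiP; exists phi.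
Qed.
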